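(* Let $B\in\mathbb{R}^{X\times X}$ be the projected transition matrix of a two-reflection walk, with spectral decomposition $B=\sum_\theta\theta E_\theta$. Let $u\in X$ and let $\Lambda=\{\theta\mid E_\theta(u,u)\ne 0\}$ be the eigenvalue support of $u$. There is periodicity at $u$ if and only if each $\theta\in\Lambda$ is a cosine of a rational multiple of $\pi$: $$\theta=\cos\frac{p(\theta)\pi}{q(\theta)},$$ where $p(\theta)\ge 0$ and $q(\theta)>0$ are integers such that $p(\theta)\le q(\theta)$ and $\gcd(p(\theta),q(\theta))=1$. If this is the case, let $\tau=\operatorname{lcm}\{q(\theta)\mid\theta\in\Lambda\}$. The period is $\tau$ if $\tau\cdot\frac{p(\theta)}{q(\theta)}$ has the same parity for all $\theta\in\Lambda$. Otherwise, the period is $2\tau$.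
   Context: Two-reflection walk (real case): $\mathcal{A},X,Y$ are finite sets, $N\in\mathbb{R}^{\mathcal{A}\times X}$ and $M\in\mathbb{R}^{\mathcal{A}\times Y}$ are matrices with orthonormal columns ($N^TN=I$, $M^TM=I$), and the transition matrix is $U=(2MM^T-I)(2NN^T-I)$. For integers $t\ge 0$ put $B_t=N^TU^tN$, a symmetric real matrix; the projected transition matrix is $B=B_1$. Spectral decomposition: $B=\sum_\theta\theta E_\theta$, the sum running over the distinct eigenvalues $\theta$ of $B$, with $E_\theta$ the orthogonal projection onto the $\theta$-eigenspace. There is periodicity at $u$ if there exist an integer $t>0$ and $\gamma\in\mathbb{C}$ with $|\gamma|=1$ such that $U^tN\mathbf{e}_u=\gamma N\mathbf{e}_u$ (equivalently $|B_t(u,u)|=1$), where $\mathbf{e}_u$ is the standard basis vector indexed by $u$; the smallest such $t$ is the period. *)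

(* Defs.v *)
From mathcomp Require Import all_boot all_order all_algebra.
From mathcomp Require Import all_classical all_reals all_analysis.
From mathcomp Require Import complex.

Set Implicit Arguments.
Unset Strict Implicit.
Unset Printing Implicit Defensive.

Import Order.TTheory GRing.Theory Num.Theory.
Local Open Scope classical_set_scope.
Local Open Scope ring_scope.

(* A reflection only when the columns of N are orthonormal. *)
Definition col_reflection (R : realType) (a n : nat) (N : 'M[R]_(a, n)) :
  'M[R]_a := 2 *: (N *m N^T) - 1%:M.

Definition transition_mx (R : realType) (a x y : nat)
    (N : 'M[R]_(a, x)) (M : 'M[R]_(a, y)) : 'M[R]_a :=
  col_reflection M *m col_reflection N.

Definition projected_power (R : realType) (a x y : nat)
    (N : 'M[R]_(a, x)) (M : 'M[R]_(a, y)) (t : nat) : 'M[R]_x :=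
  N^T *m (transition_mx N M ^+ t) *m N.

Definition projected_transition (R : realType) (a x y : nat)
    (N : 'M[R]_(a, x)) (M : 'M[R]_(a, y)) : 'M[R]_x :=
  projected_power N M 1.

(* Subspaces are row spaces, and kermx V^T is the orthogonal complement of the
   row space of V.  The resulting matrix is symmetric, so it does not matter
   that proj_mx acts on row vectors. *)
Definition orth_proj (R : realType) (n : nat) (V : 'M[R]_n) : 'M[R]_n :=
  proj_mx V (kermx V^T).

(* MathComp's eigenspace is the left (row) eigenspace; for the symmetric
   matrices N^T U^t N it agrees with the right one. *)
Definition eigenprojection (R : realType) (n : nat) (B : 'M[R]_n) (theta : R) :
  'M[R]_n := orth_proj (eigenspace B theta).

Definition eigenvalue_support (R : realType) (n : nat) (B : 'M[R]_n)
    (u : 'I_n) : set R :=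
  [set theta | eigenvalue B theta /\ eigenprojection B theta u u != 0].

(* Finiteness makes a big operator over the support a genuine finite
   iteration: fsbigop returns the neutral element on infinite supports. *)
Lemma finite_eigenvalue_support (R : realType) (n : nat) (B : 'M[R]_n)
  (u : 'I_n) : finite_set (eigenvalue_support B u).
Proof.
have B0 : char_poly B != 0 by exact: monic_neq0 (char_poly_monic B).
have [s Bs] := closed_field_poly_normal (map_poly (real_complex R) (char_poly B)).
apply: (@sub_finite_set _ _ [set theta | theta \in [seq complex.Re z | z <- s]]);
  last exact: finite_seq.
move=> theta [+ _] /=; rewrite eigenvalue_root_char => rt.
apply/mapP; exists (theta%:C)%C => //.
have : root (map_poly (real_complex R) (char_poly B)) (theta%:C)%C.
  by rewrite fmorph_root.
rewrite Bs rootZ ?root_prod_XsubC// lead_coef_eq0.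
by rewrite map_poly_eq0.
Qed.

(* gamma is complex, so the real vectors U^t N e_u and N e_u are compared after
   embedding R into R[i]. *)
Definition returns_at (R : realType) (a x y : nat)
    (N : 'M[R]_(a, x)) (M : 'M[R]_(a, y)) (u : 'I_x) (t : nat) : Prop :=
  exists gamma : R[i], `|gamma| = 1 /\
    map_mx (real_complex R)
      ((transition_mx N M ^+ t) *m (N *m (delta_mx u 0 : 'cV[R]_x))) =
    gamma *: map_mx (real_complex R) (N *m (delta_mx u 0 : 'cV[R]_x)).

Definition periodic_at (R : realType) (a x y : nat)
    (N : 'M[R]_(a, x)) (M : 'M[R]_(a, y)) (u : 'I_x) : Prop :=
  exists t : nat, (0 < t)%N /\ returns_at N M u t.

Definition is_period (R : realType) (a x y : nat)
    (N : 'M[R]_(a, x)) (M : 'M[R]_(a, y)) (u : 'I_x) (t : nat) : Prop :=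
  [/\ (0 < t)%N, returns_at N M u t &
      forall s : nat, (0 < s)%N -> returns_at N M u s -> (t <= s)%N].

Definition cos_rational_angle (R : realType) (theta : R) (p q : nat) : Prop :=
  [/\ (0 < q)%N, (p <= q)%N, coprime p q & theta = cos (p%:R * pi / q%:R)].

(* Main.v *)
Require Import Defs.
From mathcomp Require Import all_boot all_order all_algebra.
From mathcomp Require Import all_classical all_reals all_analysis.
From mathcomp Require Import complex.
From mathcomp Require Import ring.

Set Implicit Arguments.
Unset Strict Implicit.
Unset Printing Implicit Defensive.

Import Order.TTheory GRing.Theory Num.Theory.
Local Open Scope classical_set_scope.
Local Open Scope ring_scope.

(** Write [U] for the transition matrix, [B] for the projected one, [e] for the
    basis vector at [u] and [B_t = N^T U^t N].

    The reflections fix their own columns and square to the identity, so the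
    [B_t] satisfy the Chebyshev recurrence [B_(t+2) = 2 B B_(t+1) - B_t]
    ([projected_powerSS]).  Hence an eigenvector of [B] for [cos phi] is an
    eigenvector of [B_t] for [cos (t phi)] ([projected_power_eigen]).  All
    eigenvalues of [B] lie in [-1, 1] because [B] is a compression of a
    reflection ([eigenvalue_bound]), so all of them are cosines.

    Since [U] and [N e] are real and [N e] is nonzero, a return at time [t]
    means [U^t N e = s N e] with a sign [s] ([returns_at_sign]).  Such a return
    gives [B_t e = s e], and pairing this with the component [e^T E_theta] of
    [e], whose product with [e] is [E_theta(u,u)], gives [cos (t phi) = s] for
    every [theta = cos phi] in the support.  Conversely, [B] is symmetric, so
    [e] is the sum of its components in the eigenspaces, and those outside the
    support vanish because [E_theta(u,u)] is the squared norm of the component.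
    If [cos (t phi) = s] throughout the support then [e^T B_t = s e^T]; thus the
    unit vectors [U^t N e] and [s N e] have inner product 1 and coincide.
    Therefore [u] returns at time [t] exactly when [cos (t phi)] is the same
    sign for all support eigenvalues [cos phi] ([returns_at_cos]).

    The rest is arithmetic.  A value [cos (t phi) = 1] or [-1] with [t > 0]
    makes [phi] a rational multiple of [pi].  For [phi = p pi / q] in lowest
    terms, [cos (t phi)] is a sign exactly when [q] divides [t], and the sign is
    then the parity of [t p / q].  So every return time is a multiple of the
    least common multiple [tau] of the denominators, [tau] itself is a return
    time exactly when the parities agree, and [2 tau] always is one. *)

(** * Orthogonal projections and symmetric real matrices *)

Lemma mulmx_tr_ge0 (R : realDomainType) (n : nat) (v : 'rV[R]_n) :
  0 <= (v *m v^T) 0 0.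
Proof. by rewrite mxE; apply: sumr_ge0 => i _; rewrite mxE -expr2 sqr_ge0. Qed.

Lemma mulmx_tr_eq0 (R : realDomainType) (n : nat) (v : 'rV[R]_n) :
  ((v *m v^T) 0 0 == 0) = (v == 0).
Proof.
apply/eqP/eqP => [|->]; last by rewrite mul0mx mxE.
rewrite mxE => v0; apply/rowP => i; rewrite mxE.
have vi0 : v 0 i * v^T i 0 = 0.
  by apply: (psumr_eq0P _ v0) => // j _; rewrite mxE -expr2 sqr_ge0.
by apply/eqP; move/eqP: vi0; rewrite mxE mulf_eq0 orbb.
Qed.

Lemma mulmx_tr_gt0 (R : realDomainType) (n : nat) (v : 'rV[R]_n) :
  (0 < (v *m v^T) 0 0) = (v != 0).
Proof. by rewrite lt_neqAle mulmx_tr_ge0 eq_sym mulmx_tr_eq0 andbT. Qed.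

Lemma orth_compl_disj (R : realFieldType) (n : nat) (V : 'M[R]_n) :
  (V :&: kermx V^T = 0)%MS.
Proof.
apply/eqP; rewrite -submx0; apply/rV_subP => v.
rewrite sub_capmx => /andP[/submxP[c vE] /sub_kermxP vV].
rewrite submx0 -mulmx_tr_eq0 {2}vE trmx_mul mulmxA vV mul0mx mxE//.
Qed.

Lemma orth_compl_full (R : realFieldType) (n : nat) (V : 'M[R]_n) :
  row_full (V + kermx V^T)%MS.
Proof.
rewrite /row_full mxrank_disjoint_sum ?orth_compl_disj// mxrank_ker mxrank_tr.
by rewrite subnKC ?rank_leq_row.
Qed.

(** Orthogonality of the projection: [v - w] is orthogonal to [w], so the inner
    product of [v] with its projection [w] is the squared norm of [w]. *)
Lemma orth_proj_norm (R : realType) (n : nat) (V : 'M[R]_n) (v : 'rV[R]_n)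
    (w := v *m orth_proj V) : w *m v^T = w *m w^T.
Proof.
have wV : (w <= V)%MS by exact: proj_mx_sub.
have : (v - w <= kermx V^T)%MS.
  by apply: proj_mx_compl_sub; rewrite submx_full ?orth_compl_full.
move=> /sub_kermxP vw; clearbody w; apply: trmx_inj; rewrite !trmx_mul !trmxK.
have /submxP[c wE] := wV.
apply/eqP; rewrite -subr_eq0 -mulmxBl {2}wE trmx_mul mulmxA vw.
by rewrite mul0mx.
Qed.

(** Over [R[i]] the matrix [B] is Hermitian, hence similar to a real diagonal
    matrix; real matrices that are similar over [R[i]] are similar over [R]. *)
Lemma symmetric_diagonalizable (R : rcfType) (n : nat) (B : 'M[R]_n) :
  B^T = B -> diagonalizable B.
Proof.
move=> Bsym.
pose rc := real_complex R.
have real_rc m k (C : 'M[R]_(m, k)) : map_mx rc C \is a mxOver Num.real.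
  by apply/mxOverP => i j; rewrite mxE /rc complex_real.
have real_lift m k (C : 'M[R[i]]_(m, k)) : C \is a mxOver Num.real ->
    exists D : 'M[R]_(m, k), C = map_mx rc D.
  move=> /mxOverP Creal; exists (\matrix_(i, j) complex.Re (C i j)).
  by apply/matrixP => i j; rewrite !mxE [RHS]RRe_real.
have Bherm : map_mx rc B \is hermsymmx.
  apply: realsym_hermsym => //.
  by apply/is_hermitianmxP; rewrite expr0 scale1r map_mx_id// map_trmx Bsym.
have [d dE] := real_lift _ _ _ (hermitian_spectral_diag_real Bherm).
have /orthomx_spectralP := hermitian_normalmx Bherm.
rewrite dE => BE.
have : similar_in unitmx (map_mx rc B) (diag_mx (map_mx rc d)).
  exists (spectralmx (map_mx rc B)); first exact: spectral_unit.
  apply/similarP; first exact: spectral_unit.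
  by rewrite {2}BE -mulmxA mulKVmx ?spectral_unit.
rewrite -map_diag_mx.
case/real_similar => // Q; rewrite inE => /andP[/real_lift[P ->]].
rewrite map_unitmx => Punit /similarP; rewrite map_unitmx => /(_ Punit).
rewrite -!map_mxM => /map_mx_inj PB.
exists P => //; apply/diagonalizable_forPex; exists d; exact/similarP.
Qed.

(** The spectral decomposition of a vector.  The list [rs] may contain reals that
    are not eigenvalues of [B]; their eigenprojection is zero. *)
Lemma row_eigen_decomposition (R : realType) (n : nat) (B : 'M[R]_n)
    (e : 'rV[R]_n) : B^T = B ->
  exists rs : seq R, e = \sum_(r <- rs) e *m eigenprojection B r.
Proof.
move=> Bsym; have /diagonalizablePeigen[rs urs] := symmetric_diagonalizable Bsym.
rewrite (big_nth 0) big_mkord => rsP; exists rs.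
have /sub_sumsmxP[c eE] : (e <= \sum_(i < size rs) eigenspace B rs`_i)%MS.
  by rewrite rsP submx1.
rewrite (big_nth 0) big_mkord {1}eE; apply: eq_bigr => i _.
rewrite eE mulmx_suml (bigD1 i)//= proj_mx_id ?orth_compl_disj ?submxMl//.
rewrite big1 ?addr0// => j ji; apply: proj_mx_0; first exact: orth_compl_disj.
apply: submx_trans (submxMl _ _) _; apply/sub_kermxP.
(* Eigenspaces of a symmetric matrix for distinct eigenvalues are orthogonal. *)
set V := eigenspace B _; set W := eigenspace B _.
have VB : V *m B = rs`_j *: V by apply/eigenspaceP.
have WB : W *m B = rs`_i *: W by apply/eigenspaceP.
have : (rs`_j - rs`_i) *: (V *m W^T) = 0.
  apply/eqP; rewrite scalerBl subr_eq0 scalemxAl -VB -mulmxA -{1}Bsym -trmx_mul.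
  by rewrite WB linearZ/= -scalemxAr.
move/eqP; rewrite scaler_eq0 subr_eq0 nth_uniq// => /orP[/eqP ji'|/eqP//].
by rewrite (val_inj ji') eqxx in ji.
Qed.

(** * Angles whose multiples have cosine 1 or -1 *)

Lemma cos_mulrSS (R : realType) (t : nat) (phi : R) :
  cos (t.+2%:R * phi) =
  2 * cos phi * cos (t.+1%:R * phi) - cos (t%:R * phi).
Proof.
have -> : t.+2%:R * phi = t.+1%:R * phi + phi.
  by rewrite -[t.+2]addn1 natrD mulrDl mul1r.
have -> : t%:R * phi = t.+1%:R * phi - phi.
  by rewrite -[t.+1]addn1 natrD mulrDl mul1r addrK.
rewrite cosB cosD; ring.
Qed.

Lemma cos_natpi (R : realType) (k : nat) (x : R) :
  cos (x + k%:R * pi) = (-1) ^+ odd k * cos x.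
Proof. by rewrite mulr_natl (alternatingn (@cosDpi R)) signr_odd. Qed.

Lemma cos_rational_pi (R : realType) (m q : nat) (b : bool) : (0 < q)%N ->
  cos (m%:R * pi / q%:R) = (-1) ^+ b :> R <->
  (q %| m)%N /\ odd (m %/ q) = b.
Proof.
move=> q0; have qR : 0 < q%:R :> R by rewrite ltr0n.
have E : m%:R * pi / q%:R = (m %% q)%:R * pi / q%:R + (m %/ q)%:R * pi :> R.
  rewrite {1}(divn_eq m q) natrD natrM; field; exact: lt0r_neq0.
rewrite E cos_natpi; split.
  move=> h.
  (* The remainder angle lies in [0, pi[ and its sine vanishes, so it is zero. *)
  have sin0 : sin ((m %% q)%:R * pi / q%:R) = 0 :> R.
    apply/eqP; rewrite -sqrf_eq0 sin2cos2 subr_eq0 eq_sym.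
    have /(congr1 (fun z => z ^+ 2)) := h.
    by rewrite exprMn !sqrr_sign mul1r => ->.
  have [r0|r0] := posnP (m %% q).
    split; first by rewrite /dvdn r0.
    by move: h; rewrite r0 !mul0r cos0 mulr1 => /signr_inj.
  have : 0 < sin ((m %% q)%:R * pi / q%:R) :> R.
    apply: sin_gt0_pi; rewrite divr_gt0 ?mulr_gt0 ?pi_gt0 ?ltr0n//=.
    by rewrite ltr_pdivrMr// mulrC ltr_pM2l ?pi_gt0// ltr_nat ltn_mod.
  by rewrite sin0 ltxx.
by case=> /eqP -> <-; rewrite !mul0r cos0 mulr1.
Qed.

(** If [t phi] has cosine 1 or -1 for some [t > 0], then [t phi = k pi] for an
    integer [k], and [k / t] is reduced to lowest terms. *)
Lemma rational_angle_of_cos_sign (R : realType) (t : nat) (b : bool) (phi : R) :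
  (0 < t)%N -> 0 <= phi <= pi -> cos (t%:R * phi) = (-1) ^+ b ->
  exists p q : nat, cos_rational_angle (cos phi) p q.
Proof.
move=> t0 /andP[phi0 phipi] ct.
have tR : 0 < t%:R :> R by rewrite ltr0n.
have pi0 := pi_gt0 R.
pose k := Num.truncn (t%:R * phi / pi).
have /truncn_itv/andP[kle klt] : 0 <= t%:R * phi / pi.
  by rewrite divr_ge0 ?mulr_ge0// ltW.
rewrite -/k in kle klt.
rewrite ler_pdivlMr// in kle.
rewrite ltr_pdivrMr// -addn1 natrD mulrDl mul1r in klt.
(* [t phi - k pi] lies in [0, pi[ and its sine vanishes, so it is zero. *)
have phiE : t%:R * phi = k%:R * pi.
  apply/eqP; move: kle; rewrite le_eqVlt => /predU1P[->//|kl].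
  have : 0 < sin (t%:R * phi - k%:R * pi).
    by apply: sin_gt0_pi; rewrite subr_gt0 kl/= ltrBlDl.
  suff -> : sin (t%:R * phi - k%:R * pi) = 0 by rewrite ltxx.
  apply/eqP; rewrite -sqrf_eq0 sin2cos2 subr_eq0 eq_sym.
  move: ct; rewrite -(subrK (k%:R * pi) (t%:R * phi)) cos_natpi.
  move=> /(congr1 (fun z => z ^+ 2)).
  by rewrite exprMn !sqrr_sign mul1r subrK => ->.
pose d := gcdn k t.
have d0 : (0 < d)%N by rewrite gcdn_gt0 t0 orbT.
have kE : (k = k %/ d * d)%N by rewrite divnK ?dvdn_gcdl.
have tE : (t = t %/ d * d)%N by rewrite divnK ?dvdn_gcdr.
have kt : (k <= t)%N.
  by rewrite -(ler_nat R) -(ler_pM2r pi0) -phiE ler_pM2l.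
exists (k %/ d)%N, (t %/ d)%N; split.
- by rewrite divn_gt0// dvdn_leq// dvdn_gcdr.
- by rewrite leq_div2r.
- by rewrite /coprime -(eqn_pmul2r d0) muln_gcdl -kE -tE mul1n.
congr cos; apply: (mulfI (lt0r_neq0 tR)); rewrite phiE.
have dR : (d%:R : R) != 0 by rewrite pnatr_eq0 -lt0n.
have qR : ((t %/ d)%:R : R) != 0.
  by rewrite pnatr_eq0 -lt0n divn_gt0// dvdn_leq// dvdn_gcdr.
have -> : k%:R = (k %/ d)%:R * d%:R :> R by rewrite -natrM -kE.
have -> : t%:R = (t %/ d)%:R * d%:R :> R by rewrite -natrM -tE.
by field.
Qed.

(** * The projected powers of a two-reflection walk *)

Section Walk.
Variables (R : realType) (a x y : nat).
Variables (N : 'M[R]_(a, x)) (M : 'M[R]_(a, y)).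
Hypotheses (N1 : N^T *m N = 1%:M) (M1 : M^T *m M = 1%:M).
Let U := transition_mx N M.
Let Bt := projected_power N M.
Let B := projected_transition N M.

Lemma tr_col_reflection n (L : 'M[R]_(a, n)) :
  (col_reflection L)^T = col_reflection L.
Proof. by rewrite /col_reflection linearB linearZ/= trmx_mul trmxK trmx1. Qed.

Lemma col_reflection_mulmx n (L : 'M[R]_(a, n)) : L^T *m L = 1%:M ->
  col_reflection L *m L = L.
Proof.
move=> L1; rewrite /col_reflection mulmxBl mul1mx -scalemxAl -mulmxA L1 mulmx1.
by rewrite scaler_nat mulr2n addrK.
Qed.

Lemma mulmx_col_reflection n (L : 'M[R]_(a, n)) : L^T *m L = 1%:M ->
  L^T *m col_reflection L = L^T.
Proof.
by move=> L1; rewrite -{1}(tr_col_reflection L) -trmx_mul col_reflection_mulmx.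
Qed.

Lemma col_reflectionK n (L : 'M[R]_(a, n)) : L^T *m L = 1%:M ->
  col_reflection L *m col_reflection L = 1%:M.
Proof.
move=> L1; rewrite {2}/col_reflection mulmxBr mulmx1 -scalemxAr mulmxA.
rewrite col_reflection_mulmx// /col_reflection opprB addrC subrK//.
Qed.

Lemma transition_mx_orthogonal : U^T *m U = 1%:M.
Proof.
rewrite /U /transition_mx trmx_mul !tr_col_reflection mulmxA.
rewrite -(mulmxA _ (col_reflection M) (col_reflection M)) col_reflectionK//.
by rewrite mulmx1 col_reflectionK.
Qed.

Lemma transition_mxX_orthogonal t : (U ^+ t)^T *m U ^+ t = 1%:M.
Proof.
elim: t => [|t IH]; first by rewrite expr0 trmx1 mulmx1.
rewrite exprSr -mulmxE trmx_mul mulmxA -(mulmxA U^T) IH mulmx1.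
exact: transition_mx_orthogonal.
Qed.

Lemma projected_transitionE : B = N^T *m col_reflection M *m N.
Proof.
rewrite /B /projected_transition /projected_power expr1 /transition_mx mulmxA.
by rewrite -!mulmxA col_reflection_mulmx.
Qed.

Lemma tr_projected_transition : B^T = B.
Proof.
by rewrite projected_transitionE !trmx_mul trmxK tr_col_reflection mulmxA.
Qed.

Lemma projected_power0 : Bt 0 = 1%:M.
Proof. by rewrite /Bt /projected_power expr0 mulmx1. Qed.

(** The Chebyshev recurrence, which makes [B_t] the [t]-th Chebyshev polynomial of
    the first kind evaluated at [B]. *)
Lemma projected_powerSS t : Bt t.+2 = 2 *: (B *m Bt t.+1) - Bt t.
Proof.
rewrite /Bt /projected_power -/U.
have NU Z : N^T *m (U *m Z) =
    N^T *m col_reflection M *m (2 *: (N *m (N^T *m Z)) - Z).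
  rewrite /U /transition_mx -!mulmxA; congr (_ *m (_ *m _)).
  by rewrite {1}/col_reflection mulmxBl mul1mx -scalemxAl mulmxA.
have NMU Z : N^T *m col_reflection M *m (U *m Z) = N^T *m Z.
  rewrite /U /transition_mx -!mulmxA (mulmxA (col_reflection M) (col_reflection M)).
  by rewrite col_reflectionK// mul1mx mulmxA mulmx_col_reflection.
(* [N^T U = N^T (2 M M^T - 1) (2 N N^T - 1)]; expanding the second
   reflection leaves the factor [N^T (2 M M^T - 1) U], in which the reflections
   in [M] cancel and the one in [N] is absorbed by [N^T]. *)
rewrite exprS -mulmxE NU mulmxBr mulmxBl projected_transitionE.
rewrite -scalemxAr -scalemxAl; congr (_ *: _ - _); first by rewrite !mulmxA.
by rewrite exprS -mulmxE NMU.
Qed.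

Lemma projected_power_eigen (w : 'rV[R]_x) phi t :
  w *m B = cos phi *: w -> w *m Bt t = cos (t%:R * phi) *: w.
Proof.
move=> wB.
suff /(_ t)[] : forall t, w *m Bt t = cos (t%:R * phi) *: w /\
    w *m Bt t.+1 = cos (t.+1%:R * phi) *: w by [].
elim=> [|k [IH0 IH1]].
  by rewrite projected_power0 mulmx1 mul0r cos0 scale1r mul1r; split.
split=> //; rewrite projected_powerSS cos_mulrSS mulmxBr -scalemxAr mulmxA wB.
by rewrite -scalemxAl IH0 IH1 !scalerA -scalerBl.
Qed.

(** If [w B = theta w], then [theta w] is [z N] for [z = w N^T (2 M M^T - 1)],
    which has the norm of [w]; and [z N] is not longer than [z] since [N N^T] is
    an orthogonal projection. *)
Lemma eigenvalue_bound theta : eigenvalue B theta -> -1 <= theta <= 1.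
Proof.
move=> /eigenvalueP[w wB w0].
have wpos : 0 < (w *m w^T) 0 0 by rewrite mulmx_tr_gt0.
pose z := w *m N^T *m col_reflection M.
have zN : z *m N = theta *: w by rewrite -wB projected_transitionE !mulmxA.
have zz : z *m z^T = w *m w^T.
  rewrite /z !trmx_mul trmxK tr_col_reflection !mulmxA.
  rewrite -(mulmxA _ (col_reflection M) (col_reflection M)) col_reflectionK//.
  by rewrite mulmx1 -(mulmxA w) N1 mulmx1.
have Nz : N^T *m z^T = (theta *: w)^T by rewrite -trmx_mul zN.
have := mulmx_tr_ge0 (z - theta *: w *m N^T).
have -> : (z - theta *: w *m N^T) *m (z - theta *: w *m N^T)^T =
    (1 - theta ^+ 2) *: (w *m w^T).
  clearbody z; rewrite [(_ - _)^T]raddfB/= trmx_mul trmxK mulmxBr !mulmxBl.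
  rewrite zz !mulmxA zN.
  rewrite -(mulmxA (theta *: w) N^T N) N1 mulmx1 subrr subr0.
  rewrite -mulmxA Nz linearZ/= -scalemxAl -scalemxAr.
  by rewrite scalerA scalerBl scale1r expr2.
by rewrite mxE pmulr_lge0// subr_ge0 -ler_norml -real_normK ?num_real// expr_le1.
Qed.

Let e u : 'cV[R]_x := delta_mx u 0.

(** The phase of a return is real, because it is the ratio of two real coordinates
    of [U^t N e] and [N e]. *)
Lemma returns_at_sign u t : returns_at N M u t <->
  exists b : bool, U ^+ t *m (N *m e u) = (-1) ^+ b *: (N *m e u).
Proof.
split=> [[gamma [gamma1]] | [b E]]; last first.
  exists ((-1) ^+ b); split; first by rewrite normr_sign.
  by rewrite E map_mxZ rmorph_sign.
set s := N *m e u; set r := _ *m s => E.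
have s0 : s != 0.
  apply/eqP => s0; have := mulmxA N^T N (e u).
  rewrite -/s s0 mulmx0 N1 mul1mx => /matrixP/(_ u 0)/eqP.
  by rewrite !mxE !eqxx eq_sym oner_eq0.
have [i si] : exists i, s i 0 != 0.
  apply: contrapT => /forallNP h; case/eqP: s0; apply/colP => i.
  by rewrite [RHS]mxE; apply/eqP/negPn/negP/h.
have gE : gamma = (r i 0 / s i 0)%:C%C.
  rewrite rmorphM fmorphV; apply: canRL (mulfK _) _; first by rewrite fmorph_eq0.
  by move/matrixP/(_ i 0): E; rewrite !mxE.
have [b bE] : exists b : bool, r i 0 / s i 0 = (-1) ^+ b.
  exists (r i 0 / s i 0 < 0).
  rewrite -[LHS]mulr_sign_norm.
  move: gamma1; rewrite gE normc_def/= expr0n addr0 sqrtr_sqr.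
  by move=> /(congr1 (@complex.Re R))/= ->; rewrite mulr1.
exists b; apply: (@map_mx_inj _ _ (real_complex R)).
by rewrite E gE bE map_mxZ.
Qed.

(** The return times at [u] in terms of angles: [phi] is any choice of an angle
    for each eigenvalue in the support. *)
Lemma returns_at_cos u (phi : R -> R) t :
  (forall theta, eigenvalue_support B u theta -> theta = cos (phi theta)) ->
  returns_at N M u t <-> exists b : bool, forall theta,
    eigenvalue_support B u theta -> cos (t%:R * phi theta) = (-1) ^+ b.
Proof.
move=> phiP; rewrite returns_at_sign.
have uE theta : eigenprojection B theta u u =
    ((e u)^T *m eigenprojection B theta *m e u) 0 0.
  by rewrite trmx_delta -rowE -colE !mxE.
split=> -[b bP]; exists b.
  move=> theta th; have [_] := th; rewrite uE; set w := (e u)^T *m _ => w0.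
  have wB : w *m B = cos (phi theta) *: w.
    by rewrite -phiP//; apply/eigenspaceP; exact: proj_mx_sub.
  have Be : Bt t *m e u = (-1) ^+ b *: e u.
    by rewrite /Bt /projected_power -!mulmxA bP -scalemxAr mulmxA N1 mul1mx.
  apply: (mulIf w0); have := congr1 (mulmx w) Be.
  rewrite mulmxA (projected_power_eigen _ wB).
  by rewrite -scalemxAl -scalemxAr => /matrixP/(_ 0 0); rewrite !mxE.
have [rs eE] := row_eigen_decomposition (e u)^T tr_projected_transition.
have Be : (e u)^T *m Bt t = (-1) ^+ b *: (e u)^T.
  rewrite eE mulmx_suml scaler_sumr; apply: eq_big_seq => r rrs.
  set w := (e u)^T *m _.
  have wB : w *m B = r *: w by apply/eigenspaceP; exact: proj_mx_sub.
  have [->|w0] := eqVneq w 0; first by rewrite mul0mx scaler0.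
  have Lr : eigenvalue_support B u r.
    split; first by apply/eigenvalueP; exists w.
    by rewrite uE -[X in _ *m X]trmxK orth_proj_norm mulmx_tr_eq0.
  by rewrite (projected_power_eigen (phi := phi r)) -?phiP// bP.
set s := N *m e u.
have ss : s^T *m s = (e u)^T *m e u.
  by rewrite /s trmx_mul !mulmxA -(mulmxA _ N^T) N1 mulmx1.
have sUs : s^T *m (U ^+ t *m s) = (-1) ^+ b *: (s^T *m s).
  by rewrite ss scalemxAl -Be /s trmx_mul /Bt /projected_power !mulmxA.
clearbody s.
have Uss : (U ^+ t *m s)^T *m s = (-1) ^+ b *: (s^T *m s).
  apply: trmx_inj; rewrite trmx_mul trmxK sUs linearZ/=.
  by rewrite trmx_mul trmxK.
have UsUs : (U ^+ t *m s)^T *m (U ^+ t *m s) = s^T *m s.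
  by rewrite trmx_mul mulmxA -(mulmxA s^T) transition_mxX_orthogonal mulmx1.
(* The squared norm of [U^t s - (-1)^b s] is zero. *)
apply/eqP; rewrite -subr_eq0 -trmx_eq0 -mulmx_tr_eq0 trmxK.
rewrite [(_ - _)^T]raddfB/= mulmxBl !mulmxBr UsUs [(_ *: s)^T]linearZ/=.
rewrite -!scalemxAl -!scalemxAr.
by rewrite sUs Uss !scalerA -!expr2 sqrr_sign !scale1r !subrr mxE.
Qed.

End Walk.

(** * Least common multiples over a finite set *)

Lemma fsbig_lcmn_sup (T : choiceType) (A : set T) (F : T -> nat) i :
  finite_set A -> A i -> (F i %| \big[lcmn/1%N]_(j \in A) F j)%N.
Proof.
move=> finA Ai; rewrite (fsbigD1 i)//=; exact: dvdn_lcml.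
Qed.

Lemma fsbig_lcmn_min (T : choiceType) (A : set T) (F : T -> nat) m :
  finite_set A -> (forall i, A i -> F i %| m)%N ->
  (\big[lcmn/1%N]_(j \in A) F j %| m)%N.
Proof.
move=> finA Fm; rewrite fsbig_finite//= big_seq.
apply: (@big_ind _ (fun k => k %| m)%N) => [//|k l km lm|i].
  by rewrite dvdn_lcm km.
by rewrite in_fset_set// inE => /Fm.
Qed.

Lemma fsbig_lcmn_gt0 (T : choiceType) (A : set T) (F : T -> nat) :
  finite_set A -> (forall i, A i -> 0 < F i)%N ->
  (0 < \big[lcmn/1%N]_(j \in A) F j)%N.
Proof.
move=> finA F0; rewrite fsbig_finite//= big_seq.
apply: (@big_ind _ (fun k => 0 < k)%N) => [//|k l k0 l0|i].
  by rewrite lcmn_gt0 k0.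
by rewrite in_fset_set// inE => /F0.
Qed.

(** * Return times and the period *)

Section Period.
Variables (R : realType) (a x y : nat).
Variables (N : 'M[R]_(a, x)) (M : 'M[R]_(a, y)).
Hypotheses (N1 : N^T *m N = 1%:M) (M1 : M^T *m M = 1%:M).
Variables (u : 'I_x) (p q : R -> nat).
Let Lambda := eigenvalue_support (projected_transition N M) u.
Hypothesis pqP : forall theta, Lambda theta ->
  cos_rational_angle theta (p theta) (q theta).
Let tau := (\big[lcmn/1%N]_(theta \in Lambda) q theta)%N.

(** Here [q theta] divides [t] by coprimality with [p theta], and the sign
    [cos (t p pi / q)] is determined by the parity of [t p / q]. *)
Lemma returns_at_dvd t : returns_at N M u t <-> exists b : bool,
  forall theta, Lambda theta ->
    (q theta %| t)%N /\ odd (t * p theta %/ q theta) = b.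
Proof.
rewrite (returns_at_cos N1 M1 (phi := fun th => (p th)%:R * pi / (q th)%:R)).
  split=> -[b bP]; exists b => theta th; have [q0 _ cpq _] := pqP th.
    have := bP _ th; rewrite mulrA mulrA -natrM.
    move=> /(cos_rational_pi _ _ _ q0)[qtp ->].
    by split=> //; rewrite -(@Gauss_dvdl _ _ (p theta))// coprime_sym.
  have [qt ob] := bP _ th.
  rewrite mulrA mulrA -natrM; apply/cos_rational_pi => //; split=> //.
  exact: dvdn_mulr.
by move=> theta /pqP[].
Qed.

Let same_parity := forall theta theta' : R, Lambda theta -> Lambda theta' ->
  odd (tau * p theta %/ q theta) = odd (tau * p theta' %/ q theta').

Lemma angle_lcm_gt0 : (0 < tau)%N.
Proof.
apply: fsbig_lcmn_gt0 => [|theta /pqP[]//].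
exact: finite_eigenvalue_support.
Qed.

Lemma dvdn_angle_lcm theta : Lambda theta -> (q theta %| tau)%N.
Proof. exact/fsbig_lcmn_sup/finite_eigenvalue_support. Qed.

Lemma angle_lcm_dvdn_return t : returns_at N M u t -> (tau %| t)%N.
Proof.
move=> /returns_at_dvd[b bP]; apply: fsbig_lcmn_min => [|theta /bP[]//].
exact: finite_eigenvalue_support.
Qed.

Lemma returns_at_angle_lcm : returns_at N M u tau <-> same_parity.
Proof.
rewrite returns_at_dvd; split=> [[b bP] th th' /bP[_ ->] /bP[_ ->]//|par].
have [[th0 L0]|/forallNP L0] := pselect (exists th0, Lambda th0).
  exists (odd (tau * p th0 %/ q th0)) => th L.
  by split; [exact: dvdn_angle_lcm|exact: par].
(* For an empty support either sign would do. *)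
by exists false => th /L0.
Qed.

Lemma returns_at_double_angle_lcm : returns_at N M u (2 * tau).
Proof.
apply/returns_at_dvd; exists false => th /dvdn_angle_lcm qt.
split; first exact: dvdn_mull.
by rewrite -mulnA -muln_divA ?dvdn_mulr// mul2n odd_double.
Qed.

Lemma is_period_angle_lcm : same_parity -> is_period N M u tau.
Proof.
move=> par; split; [exact: angle_lcm_gt0|exact/returns_at_angle_lcm|].
by move=> s s0 /angle_lcm_dvdn_return; exact: dvdn_leq.
Qed.

Lemma is_period_double_angle_lcm : ~ same_parity -> is_period N M u (2 * tau).
Proof.
move=> npar; split; first by rewrite muln_gt0 angle_lcm_gt0.
  exact: returns_at_double_angle_lcm.
move=> s s0 sP; have /dvdnP[[|[|k]] sE] := angle_lcm_dvdn_return sP.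
- by rewrite sE in s0.
- by case: npar; apply/returns_at_angle_lcm; rewrite -[tau]mul1n -sE.
- by rewrite sE leq_mul2r orbT.
Qed.

End Period.

Theorem theorem3p7 (R : realType) (a x y : nat)
    (N : 'M[R]_(a, x)) (M : 'M[R]_(a, y))
    (N_orthonormal : N^T *m N = 1%:M) (M_orthonormal : M^T *m M = 1%:M)
    (u : 'I_x) :
  let Lambda := eigenvalue_support (projected_transition N M) u in
  (periodic_at N M u <->
     forall theta : R, Lambda theta ->
       exists p q : nat, cos_rational_angle theta p q) /\
  (forall p q : R -> nat,
     (forall theta : R, Lambda theta ->
        cos_rational_angle theta (p theta) (q theta)) ->
     let tau := (\big[lcmn/1%N]_(theta \in Lambda) q theta)%N in
     let same_parity := forall theta theta' : R,
       Lambda theta -> Lambda theta' ->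
       odd (tau * p theta %/ q theta) = odd (tau * p theta' %/ q theta') in
     (same_parity -> is_period N M u tau) /\
     (~ same_parity -> is_period N M u (2 * tau))).
Proof.
move=> Lambda; split; last first.
  move=> p q pqP tau same_parity.
  split; [exact: is_period_angle_lcm|exact: is_period_double_angle_lcm].
have LI theta : Lambda theta -> -1 <= theta <= 1.
  by case=> /(eigenvalue_bound N_orthonormal M_orthonormal).
split=> [[t [t0]] | rat].
  have cosP theta : Lambda theta -> theta = cos (acos theta).
    by move=> /LI thI; rewrite acosK// in_itv/=.
  move=> /(returns_at_cos N_orthonormal M_orthonormal _ cosP)[b bP] theta th.
  rewrite (cosP _ th); apply: (rational_angle_of_cos_sign t0) (bP _ th).
  by rewrite acos_ge0 ?acos_lepi ?LI.
(* The numerators and denominators are chosen simultaneously; off the support the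
   pair is arbitrary. *)
have /choice[pq pqP] : forall theta, exists pq : nat * nat,
    Lambda theta -> cos_rational_angle theta pq.1 pq.2.
  move=> theta; have [/rat[p [q pqP]]|nL] := pselect (Lambda theta).
    by exists (p, q).
  by exists (0%N, 0%N).
pose tau := (\big[lcmn/1%N]_(theta \in Lambda) (pq theta).2)%N.
exists (2 * tau)%N; split; first by rewrite muln_gt0 (angle_lcm_gt0 pqP).
exact: (returns_at_double_angle_lcm N_orthonormal M_orthonormal pqP).
Qed.
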